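(* Let $n = p_1^{e_1}p_2^{e_2}\cdots p_t^{e_t}$ be a positive integer, with $p_1<p_2<\dots<p_t$ distinct primes and $e_1,\dots,e_t\ge 1$. Then the set $\{\, u_{p_i,j}^{<k>} \mid i=1,\dots,t,\ j=0,\dots,e_i-1,\ k=0,\dots,p_i-1 \,\}$ generates the $\mathbb{Z}_n$-module of polynomial functions from $\mathbb{Z}_n$ to itself, i.e. the set of all $\mathbb{Z}_n$-linear combinations of these functions is exactly the set of all polynomial functions $\mathbb{Z}_n\to\mathbb{Z}_n$.
   Context: $\mathbb{Z}_n$ is the ring of integers modulo $n$; each congruence class is represented by its least non-negative residue. The set of all functions $\mathbb{Z}_n\to\mathbb{Z}_n$, identified with $\mathbb{Z}_n^n$, is a $\mathbb{Z}_n$-module under pointwise operations. A function $f:\mathbb{Z}_n\to\mathbb{Z}_n$ is called polynomial if there is a polynomial $P(X)\in\mathbb{Z}_n[X]$ with $f(a)=P(a)$ for all $a\in\mathbb{Z}_n$; the polynomial functions form a $\mathbb{Z}_n$-submodule. For $i=1,\dots,t$ and $j=0,\dots,e_i-1$, the function $u_{p_i,j}:\mathbb{Z}_n\to\mathbb{Z}_n$ is defined by $u_{p_i,j}(a)=\frac{n}{p_i^{e_i}}a^j$ if $p_i\mid a$ and $u_{p_i,j}(a)=0$ if $p_i\nmid a$, where $a$ denotes the canonical representative in $\{0,\dots,n-1\}$, divisibility is as integers, and $0^0=1$. For $v:\mathbb{Z}_n\to\mathbb{Z}_n$ and $k\in\{0,\dots,n-1\}$, the cyclic shift $v^{<k>}$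 is the function $v^{<k>}(a)=v(a-k)$, $a\in\mathbb{Z}_n$ (subtraction in $\mathbb{Z}_n$). *)

(* Defs.v *)
From HB Require Import structures.
From mathcomp Require Import all_boot all_order all_algebra.

Set Implicit Arguments.
Unset Strict Implicit.
Unset Printing Implicit Defensive.

Import GRing.Theory.
Local Open Scope ring_scope.

(* The ring of integers modulo n, for every n > 0.  The library's 'Z_n is not  *)
(* used because 'Z_1 is the ring of integers modulo 2, while n = 1 (t = 0) is  *)
(* a legitimate case here.  The operations are those of zmodp.v; the coercion  *)
(* to nat gives the least non-negative residue.  (Zmod 0 is the zero ring.)    *)
Definition Zmod (n : nat) : Type := 'I_n.-1.+1.

HB.instance Definition _ n := Finite.on (Zmod n).
HB.instance Definition _ n := SubType.on (Zmod n).
HB.instance Definition _ n := GRing.Zmodule.on (Zmod n).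
HB.instance Definition _ n :=
  GRing.Zmodule_isComPzRing.Build (Zmod n)
    (@Zp_mulA _) (@Zp_mulC _) (@Zp_mul1z _) (@Zp_mul_addl _).

Lemma Zmod_natr n k : (0 < n)%N -> (k%:R : Zmod n) = (k %% n)%N :> nat.
Proof.
move=> n_gt0; elim: k => [|k IHk]; first by rewrite mod0n.
rewrite -[k.+1]addn1 natrD /= IHk /= -[in RHS]modnDmr -[in RHS]modnDml.
by case: n n_gt0 {IHk} => [|[|n]] //= _; rewrite !modn1.
Qed.

Lemma Zmod_natr_val n (a : Zmod n) : (a : nat)%:R = a.
Proof.
case: n a => [|n] a; first by rewrite [RHS]ord1 [LHS]ord1.
by apply: ord_inj; rewrite Zmod_natr // modn_small.
Qed.

(* The regular module (Zmod n)^o as codomain makes the ffun type a Zmod n-module *)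
(* under pointwise operations.                                                  *)
Definition Zfun (n : nat) := {ffun Zmod n -> (Zmod n)^o}.

HB.instance Definition _ n := GRing.Lmodule.on (Zfun n).

(* Polynomials are given by their coefficients because {poly R} requires R to *)
(* be nontrivial; see polynomial_funP for agreement with {poly R}.            *)
Definition polynomial_fun (R : pzSemiRingType) (f : R -> R) : Prop :=
  exists c : seq R, forall a, f a = \sum_(i < size c) c`_i * a ^+ i.

Lemma polynomial_funP (R : nzSemiRingType) (f : R -> R) :
  polynomial_fun f <-> exists P : {poly R}, forall a, f a = P.[a].
Proof.
split=> [[c fE] | [P fE]].
  by exists (\poly_(i < size c) c`_i) => a; rewrite fE horner_poly.
by exists P => a; rewrite fE horner_coef.
Qed.

Lemma polynomial_fun_Zmod m (f : Zmod m.+2 -> Zmod m.+2) :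
  polynomial_fun f <-> exists P : {poly 'Z_m.+2}, forall a, f a = P.[a].
Proof. exact: (@polynomial_funP 'Z_m.+2 f). Qed.

Definition lin_span (R : pzRingType) (V : lmodType R) (S : V -> Prop) (v : V)
    : Prop :=
  exists (m : nat) (c : 'I_m -> R) (w : 'I_m -> V),
    (forall i, S (w i)) /\ v = \sum_(i < m) c i *: w i.

(* u_{p,j}, where e is the exponent of p in n *)
Definition ufun (n p e j : nat) : Zfun n :=
  [ffun a : Zmod n => if (p %| a)%N then (n %/ p ^ e)%:R * a ^+ j else 0].

Definition cyclic_shift (n : nat) (v : Zfun n) (k : nat) : Zfun n :=
  [ffun a : Zmod n => v (a - k%:R)].

(* Main.v *)
Require Import Defs.
From mathcomp Require Import all_boot all_order all_algebra.
From mathcomp Require Import cyclic.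

Set Implicit Arguments.
Unset Strict Implicit.
Unset Printing Implicit Defensive.

Import GRing.Theory.
Local Open Scope ring_scope.

(** Write [q = n / p ^ e] for a prime [p] of exponent [e] in [n].  Multiplication
    by [q] in the integers modulo [n] only sees residues modulo [p ^ e]; both
    inclusions come from this.

    The generators are polynomial functions.  Modulo [p ^ e], the polynomial
    [1 - X ^ (e * totient (p ^ e))] is the indicator of the multiples of [p]:
    Euler's theorem gives [0] on units, and the exponent is at least [e], which
    gives [1] on multiples of [p] ([mulr_ppart_indicator]).  Hence
    [u_{p,j} (a) = q * (1 - a ^ (e * totient (p ^ e))) * a ^ j], and polynomial
    functions are stable under shifts, products and linear combinations.

    Conversely it is enough to generate each monomial function [a ^ m].  The sum
    of the cofactors [q] over all primes of [n] is coprime to [n]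
    ([coprime_sum_cofactors]), hence invertible modulo [n], so it is enough to
    generate each [q * a ^ m].  For every [a] exactly one [k < p] satisfies
    [p | a - k]; expanding [a ^ m = ((a - k) + k) ^ m] by the binomial formula
    writes [q * a ^ m] as a combination of shifts by [k] of the functions
    [u_{p,j}] with [j <= m] ([ppart_monomialE]).  Those with [j >= e] vanish,
    because then [q * b ^ j] is divisible by [n] as soon as [p | b]. *)

(** * Linear spans *)

Section LinSpan.

Variables (R : pzRingType) (V : lmodType R) (S : V -> Prop).

Lemma lin_span_gen v : S v -> lin_span S v.
Proof.
move=> Sv; exists 1%N, (fun=> 1), (fun=> v); split=> //.
by rewrite big_ord1 scale1r.
Qed.

Lemma lin_span0 : lin_span S 0.
Proof. by exists 0%N, (fun=> 0), (fun=> 0); split; [case | rewrite big_ord0]. Qed.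

Lemma lin_spanZ a v : lin_span S v -> lin_span S (a *: v).
Proof.
move=> [m [c [w [Sw ->]]]]; exists m, (fun i => a * c i), w; split=> //.
by rewrite scaler_sumr; apply: eq_bigr => i _; rewrite scalerA.
Qed.

Lemma lin_spanD v1 v2 : lin_span S v1 -> lin_span S v2 -> lin_span S (v1 + v2).
Proof.
move=> [m1 [c1 [w1 [Sw1 ->]]]] [m2 [c2 [w2 [Sw2 ->]]]].
pose glue T (x1 : 'I_m1 -> T) x2 (i : 'I_(m1 + m2)) :=
  match split i with inl i1 => x1 i1 | inr i2 => x2 i2 end.
exists (m1 + m2)%N, (glue _ c1 c2), (glue _ w1 w2); split=> [i|].
  by rewrite /glue; case: splitP.
rewrite big_split_ord; congr (_ + _); apply: eq_bigr => i _; rewrite /glue.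
  by rewrite (unsplitK (inl i)).
by rewrite (unsplitK (inr i)).
Qed.

Lemma lin_span_sum (I : Type) (r : seq I) (P : pred I) (F : I -> V) :
  (forall i, P i -> lin_span S (F i)) -> lin_span S (\sum_(i <- r | P i) F i).
Proof. by move=> SF; elim/big_ind: _ => //; [apply: lin_span0 | apply: lin_spanD]. Qed.

End LinSpan.

(** * The ring of polynomial functions *)

Section PolynomialFun.

(** The closure properties are proved on coefficient sequences so that they
    cover the zero ring, that is the case [n = 1]. *)
Variable R : comPzRingType.
Implicit Types f g : R -> R.

Lemma eq_polynomial_fun f g : f =1 g -> polynomial_fun f -> polynomial_fun g.
Proof. by move=> fg [c fE]; exists c => a; rewrite -fg. Qed.

Lemma sum_coef_widen (c : seq R) N a : (size c <= N)%N ->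
  \sum_(i < size c) c`_i * a ^+ i = \sum_(i < N) c`_i * a ^+ i.
Proof.
move=> leN; rewrite (big_ord_widen N (fun i => c`_i * a ^+ i) leN) big_mkcond.
apply: eq_bigr => i _; case: ltnP => // lei.
by rewrite nth_default ?mul0r.
Qed.

Lemma polynomial_fun_cst x : polynomial_fun (fun=> x : R).
Proof. by exists [:: x] => a; rewrite big_ord1 mulr1. Qed.

Lemma polynomial_fun_id : polynomial_fun (fun a : R => a).
Proof. by exists [:: 0; 1] => a; rewrite !big_ord_recl big_ord0 mul0r add0r mul1r addr0. Qed.

Lemma polynomial_funD f g :
  polynomial_fun f -> polynomial_fun g -> polynomial_fun (fun a => f a + g a).
Proof.
move=> [c fE] [d gE]; pose N := maxn (size c) (size d).
exists (mkseq (fun i => c`_i + d`_i) N) => a.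
rewrite fE gE size_mkseq (sum_coef_widen a (leq_maxl (size c) (size d))).
rewrite (sum_coef_widen a (leq_maxr (size c) (size d))) -/N.
rewrite -big_split; apply: eq_bigr => i _ /=.
by rewrite nth_mkseq // mulrDl.
Qed.

Lemma polynomial_fun_sum (I : Type) (r : seq I) (F : I -> R -> R) :
  (forall i, polynomial_fun (F i)) ->
  polynomial_fun (fun a => \sum_(i <- r) F i a).
Proof.
move=> PF; elim: r => [|i r IHr].
  by apply: eq_polynomial_fun (polynomial_fun_cst 0) => a; rewrite big_nil.
apply: eq_polynomial_fun (polynomial_funD (PF i) IHr) => a.
by rewrite big_cons.
Qed.

Lemma polynomial_funZ x f : polynomial_fun f -> polynomial_fun (fun a => x * f a).
Proof.
move=> [c fE]; exists [seq x * y | y <- c] => a.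
rewrite fE size_map mulr_sumr; apply: eq_bigr => i _.
by rewrite (nth_map 0) // mulrA.
Qed.

Lemma polynomial_fun_mulX f : polynomial_fun f -> polynomial_fun (fun a => a * f a).
Proof.
move=> [c fE]; exists (0 :: c) => a.
rewrite fE big_ord_recl mul0r add0r mulr_sumr; apply: eq_bigr => i _ /=.
by rewrite exprS mulrCA.
Qed.

Lemma polynomial_funM f g :
  polynomial_fun f -> polynomial_fun g -> polynomial_fun (fun a => f a * g a).
Proof.
move=> [c fE] Pg.
have PXg i : polynomial_fun (fun a => a ^+ i * g a).
  elim: i => [|i /polynomial_fun_mulX]; first by apply: eq_polynomial_fun Pg => a; rewrite mul1r.
  by apply: eq_polynomial_fun => a; rewrite mulrA -exprS.
apply: eq_polynomial_fun
  (polynomial_fun_sum (index_enum 'I_(size c)) (fun i => polynomial_funZ c`_i (PXg i))) => a.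
by rewrite fE mulr_suml; apply: eq_bigr => i _; rewrite mulrA.
Qed.

Lemma polynomial_funX f m : polynomial_fun f -> polynomial_fun (fun a => f a ^+ m).
Proof.
move=> Pf; elim: m => [|m IHm]; first exact: polynomial_fun_cst.
by apply: eq_polynomial_fun (polynomial_funM Pf IHm) => a; rewrite exprS.
Qed.

End PolynomialFun.

(** * Arithmetic modulo n *)

Lemma Zmod_natr_eqmod n x y : (0 < n)%N ->
  x = y %[mod n] -> x%:R = y%:R :> Zmod n.
Proof. by move=> n_gt0 xy; apply: ord_inj; rewrite !Zmod_natr. Qed.

(** Reducing modulo [p] after taking the least residue modulo [n] loses nothing
    because [p] divides [n]; this is why the supports of the shifts of [u_{p,j}]
    by [0, ..., p - 1] are exactly the residue classes modulo [p]. *)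
Lemma dvdn_Zmod_subr n p k (a : Zmod n) : (0 < n)%N -> (p %| n)%N ->
  (p %| (a - k%:R : Zmod n)%R)%N = (a == k %[mod p]).
Proof.
move=> n_gt0 p_n; set b := a - k%:R.
have -> : (a : nat) = ((b + k) %% n)%N.
  by rewrite -Zmod_natr // natrD Zmod_natr_val subrK.
by rewrite modn_dvdm // -[k in RHS]add0n eqn_modDr mod0n.
Qed.

Definition monomial n m : Zfun n := [ffun a : Zmod n => a ^+ m].

(** * Functions seen modulo a prime power *)

Section PrimePart.

Variables (n p e : nat).
Hypotheses (n_gt0 : (0 < n)%N) (p_prime : prime p) (pe_n : (p ^ e %| n)%N).
Local Notation q := (n %/ p ^ e)%N.

Lemma mulr_ppart_dvd_eq0 (b : Zmod n) j :
  (p %| b)%N -> (e <= j)%N -> q%:R * b ^+ j = 0.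
Proof.
move=> p_b le_ej; rewrite -[b]Zmod_natr_val -natrX -natrM.
apply: (Zmod_natr_eqmod (y := 0)) => //; apply/eqP; rewrite mod0n.
rewrite -[X in (_ %% X)%N](divnK pe_n); apply: dvdn_mul => //.
by apply: dvdn_trans (dvdn_exp2l p le_ej) _; apply: dvdn_exp2r.
Qed.

Lemma mulr_ppart_ndvd (b : Zmod n) m : ~~ (p %| b)%N ->
  q%:R * b ^+ (m * totient (p ^ e)) = q%:R.
Proof.
move=> p_b; rewrite -[b]Zmod_natr_val -natrX -natrM.
apply: Zmod_natr_eqmod => //; rewrite -[in RHS](muln1 q).
rewrite -[X in _ = _ %[mod X]](divnK pe_n) -!muln_modr; congr (_ * _)%N.
rewrite mulnC expnM -modnXm Euler_exp_totient ?modnXm ?exp1n //.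
by rewrite coprime_sym coprimeXl // prime_coprime.
Qed.

(** The factor [e] in the exponent only serves to make the exponent at least [e];
    any such multiple of [totient (p ^ e)] gives the same values. *)
Lemma mulr_ppart_indicator (b : Zmod n) :
  q%:R * (1 - b ^+ (e * totient (p ^ e))) = if (p %| b)%N then q%:R else 0.
Proof.
rewrite mulrBr mulr1; case: ifP => [p_b | /negbT p_b].
  rewrite mulr_ppart_dvd_eq0 ?subr0 // leq_pmulr // totient_gt0.
  by rewrite expn_gt0 prime_gt0.
by rewrite mulr_ppart_ndvd // subrr.
Qed.

Lemma polynomial_cyclic_shift_ufun j k :
  polynomial_fun (cyclic_shift (ufun n p e j) k).
Proof.
pose g (a : Zmod n) := a - k%:R.
have Pg : polynomial_fun g.
  exact: polynomial_funD (polynomial_fun_id _) (polynomial_fun_cst _).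
pose m := (e * totient (p ^ e))%N.
have P1 : polynomial_fun (fun a => 1 + (-1) * g a ^+ m).
  apply: polynomial_funD (polynomial_fun_cst _) _.
  exact: polynomial_funZ (polynomial_funX m Pg).
apply: eq_polynomial_fun (polynomial_funM (polynomial_funZ q%:R P1)
                                          (polynomial_funX j Pg)) => a.
rewrite !ffunE mulN1r mulr_ppart_indicator -/(g a).
by case: ifP => // _; rewrite mul0r.
Qed.

(** This truncates binomial expansions at degree [e - 1]. *)
Lemma ufun_eq0 j : (e <= j)%N -> ufun n p e j = 0.
Proof.
move=> le_ej; apply/ffunP => b; rewrite !ffunE.
by case: ifP => // p_b; rewrite mulr_ppart_dvd_eq0.
Qed.

(** At a given [a], only the shift by [k = a mod p] contributes, and its inner sum
    is the binomial expansion of [((a - k) + k) ^ m] times [q]. *)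
Lemma ppart_monomialE m : (0 < e)%N ->
  q%:R *: monomial n m =
  \sum_(k < p) \sum_(j < m.+1)
    (k%:R ^+ (m - j) *+ 'C(m, j)) *: cyclic_shift (ufun n p e j) k :> Zfun n.
Proof.
move=> e_gt0; have p_n : (p %| n)%N.
  by apply: dvdn_trans pe_n; apply: dvdn_exp.
apply/ffunP => a; rewrite sum_ffunE !ffunE.
have lt_ap : (a %% p < p)%N by rewrite ltn_mod prime_gt0.
pose k0 := Ordinal lt_ap.
have dvd_k (k : 'I_p) : (p %| (a - k%:R : Zmod n)%R)%N = (k == k0).
  by rewrite dvdn_Zmod_subr // (modn_small (ltn_ord k)) eq_sym.
rewrite (bigD1 k0) //= [X in _ + X]big1 => [|k /negPf k_k0]; last first.
  rewrite sum_ffunE big1 // => j _.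
  by rewrite !ffunE dvd_k k_k0 scaler0.
rewrite addr0 sum_ffunE -[a in LHS](subrK k0%:R) addrC exprDn.
rewrite scaler_sumr; apply: eq_bigr => j _.
have := dvd_k k0; rewrite eqxx !ffunE /= => ->.
have mulr_rearrange (x y z : Zmod n) l : x * (y * z *+ l) = (y *+ l) * (x * z).
  by rewrite mulrnAr mulrnAl mulrCA.
exact: mulr_rearrange.
Qed.

End PrimePart.

(** * The cofactors of the prime powers *)

Lemma coprimen_prod (I : Type) (r : seq I) (P : pred I) (F : I -> nat) m :
  (forall i, P i -> coprime m (F i)) -> coprime m (\prod_(i <- r | P i) F i).
Proof.
move=> co_m; elim/big_ind: _ => // [|x y]; first exact: coprimen1.
by rewrite coprimeMr => ->.
Qed.

Section Cofactors.

Variables (t : nat) (p e : 'I_t -> nat).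
Hypotheses (p_prime : forall i, prime (p i)) (p_inj : injective p).
Let n := (\prod_(i < t) p i ^ e i)%N.

(** Modulo [p i], every cofactor except the [i]-th vanishes, and the [i]-th is a
    product of other primes.  So one scalar, the inverse of the sum, turns the
    cofactors into a partition of unity, in place of a system of Chinese
    remainder coefficients. *)
Lemma coprime_sum_cofactors : (forall i, 0 < e i)%N ->
  coprime (\sum_(i < t) n %/ p i ^ e i) n.
Proof.
move=> e_gt0.
have qE i : (n %/ p i ^ e i = \prod_(j < t | j != i) p j ^ e j)%N.
  by rewrite /n (bigD1 i) //= mulKn // expn_gt0 prime_gt0.
have co_p i j : coprime (p i) (p j ^ e j) = (j != i).
  rewrite coprime_pexpr // prime_coprime // dvdn_prime2 //.
  by rewrite (inj_eq p_inj) eq_sym.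
set s := (\sum_(i < t) _)%N.
apply: coprimen_prod => i _.
rewrite coprimeXr // coprime_sym prime_coprime // /s (bigD1 i) //= addnC dvdn_addr.
  rewrite -prime_coprime // qE; apply: coprimen_prod => j.
  by rewrite co_p.
apply: dvdn_sum => j j_i; rewrite qE (bigD1 i) 1?eq_sym //=.
by rewrite dvdn_mulr // dvdn_exp.
Qed.

End Cofactors.

Lemma Zmod_coprime_inv n s : (0 < n)%N -> coprime s n ->
  exists c : Zmod n, c * s%:R = 1.
Proof.
move=> n_gt0 co_sn; exists (s%:R ^+ (totient n).-1).
rewrite -exprSr prednK ?totient_gt0 // -natrX.
by apply: (Zmod_natr_eqmod (y := 1)) => //; apply: Euler_exp_totient.
Qed.

Theorem theorem3p4 (t : nat) (p e : 'I_t -> nat) (n : nat)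
    (p_prime : forall i : 'I_t, prime (p i))
    (p_incr : forall i j : 'I_t, (i < j)%N -> (p i < p j)%N)
    (e_gt0 : forall i : 'I_t, (1 <= e i)%N)
    (n_def : n = (\prod_(i < t) p i ^ e i)%N)
    (f : Zfun n) :
  lin_span
    (fun v : Zfun n => exists (i : 'I_t) (j : 'I_(e i)) (k : 'I_(p i)),
       v = cyclic_shift (ufun n (p i) (e i) j) k)
    f
  <-> polynomial_fun f.
Proof.
have n_gt0 : (0 < n)%N.
  by rewrite n_def prodn_gt0 // => i; rewrite expn_gt0 prime_gt0.
have pe_n i : (p i ^ e i %| n)%N by rewrite n_def (bigD1 i) //= dvdn_mulr.
split=> [[m [c [w [Sw ->]]]] | [c fE]].
  apply: (@eq_polynomial_fun _ (fun a => \sum_(l < m) c l * w l a)) => [a|].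
    by rewrite sum_ffunE; apply: eq_bigr => l _; rewrite ffunE.
  apply: polynomial_fun_sum => l; apply: polynomial_funZ.
  by have [i [j [k ->]]] := Sw l; apply: polynomial_cyclic_shift_ufun.
set S := (fun v : Zfun n => _).
have p_inj : injective p.
  move=> i j pij; apply: ord_inj; case: (ltngtP i j) => // /p_incr.
    by rewrite pij ltnn.
  by rewrite pij ltnn.
have co_n := coprime_sum_cofactors p_prime p_inj e_gt0.
rewrite -n_def in co_n.
have [d d1] := Zmod_coprime_inv n_gt0 co_n.
have span_mono m : lin_span S (monomial n m).
  rewrite -[X in lin_span S X]scale1r -d1 -scalerA; apply: lin_spanZ.
  rewrite natr_sum scaler_suml; apply: lin_span_sum => i _.
  rewrite ppart_monomialE //.
  apply: lin_span_sum => k _; apply: lin_span_sum => j _; apply: lin_spanZ.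
  case: (ltnP j (e i)) => [lt_je | le_ej].
    by apply: lin_span_gen; exists i, (Ordinal lt_je), k.
  have -> : cyclic_shift (ufun n (p i) (e i) j) k = 0.
    by rewrite ufun_eq0 //; apply/ffunP => a; rewrite !ffunE.
  exact: lin_span0.
have -> : f = \sum_(l < size c) c`_l *: monomial n l.
  apply/ffunP => a; rewrite fE sum_ffunE.
  by apply: eq_bigr => l _; rewrite !ffunE.
by apply: lin_span_sum => l _; apply: lin_spanZ.
Qed.
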